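(* Let $V$ be an infinite dimensional real Hilbert space with dual $V^{\#}$, and let $\mathcal{A},\mathcal{B}:V\to V^{\#}$ be bounded and coercive linear operators that are self-adjoint with respect to the duality pairing. Let $\{V_n\}$ be a sequence of subspaces of $V$, with $\dim V_n=n$, satisfying the approximation property $$\lim_{n\to\infty}\ \inf_{v\in V_n}\|w-v\|=0\qquad\text{for all }w\in V.$$ For each $n$ let $(\phi_1^{(n)},\dots,\phi_n^{(n)})$ be a basis of $V_n$ and define the matrices $$\mathbf{A}_n=\left(\langle\mathcal{A}\phi_j^{(n)},\phi_i^{(n)}\rangle\right)_{i,j=1,\dots,n},\qquad \mathbf{B}_n=\left(\langle\mathcal{B}\phi_j^{(n)},\phi_i^{(n)}\rangle\right)_{i,j=1,\dots,n}.$$ Then all points in the spectrum of the preconditioned operator $\mathcal{B}^{-1}\mathcal{A}:V\to V$ are approximated to an arbitrary accuracy by the eigenvalues of the matrices $\mathbf{B}_n^{-1}\mathbf{A}_n$; that is, for any $\lambda\in\mathrm{sp}(\mathcal{B}^{-1}\mathcal{A})$ and any $\epsilon>0$ there exists $n^*$ such that $\mathbf{B}_{n^*}^{-1}\mathbf{A}_{n^*}$ has an eigenvalue $\lambda^*$ satisfying $|\lambda-\lambda^*|<\epsilon$.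
   Context: $V^{\#}$ is the space of all bounded linear functionals $V\to\mathbb{R}$, $\langle\cdot,\cdot\rangle:V^{\#}\times V\to\mathbb{R}$ is the duality pairing, and $\|\cdot\|$ is the norm of $V$. Self-adjoint with respect to the duality pairing means $\langle\mathcal{A}u,v\rangle=\langle\mathcal{A}v,u\rangle$ for all $u,v\in V$ (and likewise for $\mathcal{B}$). Coercive means that there is $\alpha>0$ with $\langle\mathcal{A}u,u\rangle\ge\alpha\|u\|^2$ for all $u\in V$ (likewise for $\mathcal{B}$, with its own constant). The spectrum $\mathrm{sp}(\mathcal{B}^{-1}\mathcal{A})$ is the complement of the resolvent set, i.e., the set of $\lambda\in\mathbb{C}$ for which $\lambda\mathcal{I}-\mathcal{B}^{-1}\mathcal{A}$ does not have a bounded inverse (for non-real $\lambda$, understood on the complexification of $V$). *)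

(* Defs.v *)
From HB Require Import structures.
From mathcomp Require Import all_boot all_order all_algebra.
From mathcomp Require Import complex.
From mathcomp Require Import all_classical all_reals all_analysis.
Set Implicit Arguments.
Unset Strict Implicit.
Unset Printing Implicit Defensive.
Import Order.TTheory GRing.Theory Num.Theory.
Import numFieldNormedType.Exports.
Local Open Scope classical_set_scope.
Local Open Scope complex_scope.
Local Open Scope ring_scope.

Section Dual.
Context {R : realType} {V : normedModType R}.

Definition bounded_functional : {pred (V -> R^o)} :=
  fun f => `[< linear f /\ exists M : R, forall v : V, `|f v| <= M * `|v| >].

Fact bounded_functional_submod : submod_closed bounded_functional.
Proof.
split.
  apply/asboolP; split=> [a u v|]; first by rewrite scaler0 add0r.
  by exists 0 => v; rewrite normr0 mul0r.
move=> a f g /asboolP[lf [Mf hf]] /asboolP[lg [Mg hg]]; apply/asboolP; split.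
  move=> b u v; rewrite !fctE lf lg !scalerDr !scalerA (mulrC a b) addrACA.
  by [].
exists (`|a| * Mf + Mg) => v; rewrite !fctE mulrDl -mulrA.
apply: (le_trans (ler_normD _ _)); apply: lerD => //.
by rewrite normrM ler_wpM2l.
Qed.

HB.instance Definition _ :=
  GRing.isSubmodClosed.Build R (V -> R^o) bounded_functional
    bounded_functional_submod.

End Dual.

(* The topological dual, a left module over R (a submodule of V -> R) whose
   elements coerce to functions: for f : dual V, the duality pairing <f, v> is
   the application f v. *)
Record dual (R : realType) (V : normedModType R) := Dual {
  pairing :> V -> R^o;
  _ : pairing \in bounded_functional }.

HB.instance Definition _ (R : realType) (V : normedModType R) :=
  [isSub for @pairing R V].
HB.instance Definition _ (R : realType) (V : normedModType R) :=
  [Choice of dual V by <:].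
HB.instance Definition _ (R : realType) (V : normedModType R) :=
  [SubChoice_isSubLmodule of dual V by <:].

Section Operators.
Context {R : realType} {V : normedModType R}.

Definition dual_norm (f : dual V) : R :=
  sup [set `|f v| | v in [set v : V | `|v| <= 1]].

Definition bounded_operator (A : V -> dual V) : Prop :=
  exists M : R, forall u : V, dual_norm (A u) <= M * `|u|.

Definition self_adjoint (A : V -> dual V) : Prop :=
  forall u v : V, A u v = A v u.

Definition coercive (A : V -> dual V) : Prop :=
  exists2 alpha : R, 0 < alpha & forall u : V, alpha * `|u| ^+ 2 <= A u u.

(* The library's choice-based inverse: it is a two-sided inverse of B as soon
   as B is bijective, which boundedness and coercivity ensure. *)
Definition inverse_operator (B : V -> dual V) : dual V -> V :=
  'pinv_(fun=> 0) [set: V] B.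

End Operators.

Section Subspaces.
Context {R : realType} {V : normedModType R}.

Definition linear_subspace (W : set V) : Prop := submod_closed [pred v | v \in W].

Definition is_basis (W : set V) (n : nat) (phi : 'I_n -> V) : Prop :=
  [/\ forall i, W (phi i),
      forall c : 'I_n -> R, \sum_i c i *: phi i = 0 -> forall i, c i = 0
    & forall w, W w -> exists c : 'I_n -> R, w = \sum_i c i *: phi i].

Definition has_dim (W : set V) (n : nat) : Prop :=
  exists phi : 'I_n -> V, is_basis W phi.

Definition infinite_dim : Prop := forall n : nat, ~ has_dim [set: V] n.

Definition distance_to (W : set V) (w : V) : R :=
  inf [set `|w - v| | v in W].

Definition galerkin_matrix (A : V -> dual V) (n : nat) (phi : 'I_n -> V) :
    'M[R]_n :=
  \matrix_(i, j) A (phi j) (phi i).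

End Subspaces.
Arguments infinite_dim {R} V.

(* The complexification of V: the pair (u, v) stands for u + i v. *)
Definition complexification (R : realType) (V : normedModType R) : Type :=
  (V * V)%type.

HB.instance Definition _ (R : realType) (V : normedModType R) :=
  GRing.Zmodule.copy (complexification V) (V * V)%type.

Section Complexification.
Context {R : realType} {V : normedModType R}.
Implicit Types (a b : R[i]) (p q : complexification V).

Definition complex_scale a p : complexification V :=
  (complex.Re a *: p.1 - complex.Im a *: p.2,
   complex.Re a *: p.2 + complex.Im a *: p.1).

Fact complex_scaleA a b p :
  complex_scale a (complex_scale b p) = complex_scale (a * b) p.
Proof.
case: a b p => [a1 a2] [b1 b2] [u v]; rewrite /complex_scale /=; congr (_, _).
  rewrite !(scalerDl, scalerDr, scalerN, scaleNr, scalerA, opprD).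
  by rewrite -!addrA; congr (_ + _); rewrite [RHS]addrC -addrA.
rewrite !(scalerDl, scalerDr, scalerN, scaleNr, scalerA).
by rewrite -!addrA; congr (_ + _); rewrite [RHS]addrC -addrA.
Qed.

Fact complex_scale1 : left_id 1 complex_scale.
Proof.
by case=> u v; rewrite /complex_scale /= !scale1r !scale0r subr0 addr0.
Qed.

Fact complex_scaleDr : right_distributive complex_scale +%R.
Proof.
move=> a [u v] [u' v'].
by rewrite /complex_scale /=; congr (_, _); rewrite /= !scalerDr ?opprD addrACA.
Qed.

Fact complex_scaleDl p : {morph complex_scale^~ p : a b / a + b}.
Proof.
case: p => u v [a1 a2] [b1 b2].
by rewrite /complex_scale /=; congr (_, _); rewrite /= !scalerDl ?opprD addrACA.
Qed.

HB.instance Definition _ :=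
  GRing.Zmodule_isLmodule.Build R[i] (complexification V)
    complex_scaleA complex_scale1 complex_scaleDr complex_scaleDl.

Definition complex_norm p : R := Num.sqrt (`|p.1| ^+ 2 + `|p.2| ^+ 2).

Definition complexify (T : V -> V) p : complexification V := (T p.1, T p.2).

End Complexification.

Definition has_bounded_inverse (R : realType) (K : nzRingType) (U : lmodType K)
    (nrm : U -> R) (T : U -> U) : Prop :=
  exists S : {linear U -> U},
    [/\ exists M : R, forall x, nrm (S x) <= M * nrm x,
        cancel S T & cancel T S].

(* For real lambda the bounded inverse is sought on V itself, for non-real
   lambda on the complexification of V. *)
Definition spectrum (R : realType) (V : normedModType R) (T : V -> V) :
    set R[i] :=
  [set lambda | if complex.Im lambda == 0
    then ~ has_bounded_inverse (fun u : V => `|u|)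
             (fun u => complex.Re lambda *: u - T u)
    else ~ has_bounded_inverse complex_norm
             (fun p : complexification V => lambda *: p - complexify T p)].

(* Main.v *)
(* With respect to the inner product [B u v], the operator [T = B^-1 A] is
   self-adjoint. If [S = a - T] and [Q = S^2 + b^2] is bounded below, then [Q]
   is coercive for this inner product, so Lax-Milgram inverts it, and with it
   the system [S u - b v = f], [S v + b u = g], which is the resolvent equation
   at [a + i b] on the complexification. Hence non-real points are never in the
   spectrum, and a real [a] is not as soon as [S] is bounded below. Simultaneous
   diagonalisation of the pencil [(A_n, B_n)] shows that, if no Galerkin
   eigenvalue is within [eps] of [a], the compression of [S] to every [V_n], and
   hence [S] on [V_n], is bounded below by [eps]; the approximation property
   carries this bound to [V]. *)
Require Import Defs.
From HB Require Import structures.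
From mathcomp Require Import all_boot all_order all_algebra.
From mathcomp Require Import complex.
From mathcomp Require Import all_classical all_reals all_analysis.
From mathcomp Require Import ring lra spectral.
Set Implicit Arguments.
Unset Strict Implicit.
Unset Printing Implicit Defensive.
Import Order.TTheory GRing.Theory Num.Theory.
Import numFieldNormedType.Exports.
Local Open Scope classical_set_scope.
Local Open Scope complex_scope.
Local Open Scope ring_scope.

(** * Symmetric bilinear forms *)

(** Linearity on the right follows by symmetry. A bare predicate suits forms built on the fly, such
    as [G (S u) (S v) - c * G u v]. *)
Definition symmetric_form (R : realType) (V : lmodType R) (G : V -> V -> R) :=
  (forall u v, G u v = G v u) /\
  (forall a u v w, G (a *: u + v) w = a * G u w + G v w).

Definition bounded_form (R : realType) (V : normedModType R)
    (G : V -> V -> R) :=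
  exists2 M : R, 0 <= M & forall u v, `|G u v| <= M * `|u| * `|v|.

Definition coercive_form (R : realType) (V : normedModType R)
    (G : V -> V -> R) :=
  exists2 alpha : R, 0 < alpha & forall u, alpha * `|u| ^+ 2 <= G u u.

Section SymmetricForm.
Context {R : realType} {V : lmodType R} {G : V -> V -> R}.
Hypothesis G_sym : symmetric_form G.

Lemma form_sym u v : G u v = G v u.
Proof. by case: G_sym. Qed.

Lemma form_linearl a u v w : G (a *: u + v) w = a * G u w + G v w.
Proof. by case: G_sym. Qed.

Lemma formDl u v w : G (u + v) w = G u w + G v w.
Proof. by rewrite -{1}(scale1r u) form_linearl mul1r. Qed.

Lemma form0l w : G 0 w = 0.
Proof. by apply: (addrI (G 0 w)); rewrite -formDl !addr0. Qed.

Lemma formZl a u w : G (a *: u) w = a * G u w.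
Proof. by rewrite -(addr0 (a *: u)) form_linearl form0l addr0. Qed.

Lemma formNl u w : G (- u) w = - G u w.
Proof. by rewrite -scaleN1r formZl mulN1r. Qed.

Lemma formBl u v w : G (u - v) w = G u w - G v w.
Proof. by rewrite formDl formNl. Qed.

Lemma formDr u v w : G w (u + v) = G w u + G w v.
Proof. by rewrite form_sym formDl !(form_sym w). Qed.

Lemma formZr a u w : G w (a *: u) = a * G w u.
Proof. by rewrite form_sym formZl (form_sym w). Qed.

Lemma formBr u v w : G w (u - v) = G w u - G w v.
Proof. by rewrite form_sym formBl !(form_sym w). Qed.

Lemma form_quadratic t u v :
  G (u + t *: v) (u + t *: v) = G u u + 2 * t * G u v + t ^+ 2 * G v v.
Proof. by rewrite !(formDl, formDr, formZl, formZr) (form_sym v u); ring. Qed.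

End SymmetricForm.

(** * The Lax-Milgram theorem for symmetric forms *)

Lemma linear_quadratic_ge0 (R : realType) (g q : R) :
  0 <= q -> (forall t, 0 <= 2 * t * g + t ^+ 2 * q) -> g = 0.
Proof.
(* For [q > 0] the polynomial is least at [- g / q]. Replacing [q] by [q + 1] covers [q = 0] and
   still gives a negative value unless [g = 0]. *)
move=> q0 /(_ (- g / (q + 1))).
have q1 : q + 1 != 0 by lra.
have -> : 2 * (- g / (q + 1)) * g + (- g / (q + 1)) ^+ 2 * q =
   - (g ^+ 2 * ((q + 2) / (q + 1) ^+ 2)) by field.
rewrite oppr_ge0 => h; have := sqr_ge0 g.
rewrite le_eqVlt eq_sym sqrf_eq0 => /orP[/eqP//|g2].
move: h; rewrite leNgt mulr_gt0 // divr_gt0 ?exprn_gt0 //; lra.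
Qed.

(* Minimising sequences of [J u = G u u - 2 f u] are Cauchy by the
   parallelogram identity, and the Euler-Lagrange equation of [J] is
   [G u = f]. *)
Theorem symmetric_lax_milgram (R : realType) (V : completeNormedModType R)
    (G : V -> V -> R) (f : V -> R) :
  symmetric_form G -> bounded_form G -> coercive_form G ->
  linear (f : V -> R^o) ->
  (exists M : R, forall v, `|f v| <= M * `|v|) ->
  exists u, forall v, G u v = f v.
Proof.
move=> Gs [K K0 GK] [al al0 Gal] flin [M fM].
pose J u := G u u - 2 * f u.
have Jvar t u v :
    J (u + t *: v) = J u + 2 * t * (G u v - f v) + t ^+ 2 * G v v.
  rewrite /J; have -> : f (u + t *: v) = f u + t * f v
    by rewrite addrC flin addrC.
  by rewrite (form_quadratic Gs); ring.
(* Complete the square in [al x^2 - 2 M x] with [x] the norm of [u]. *)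
have Jlb u : - (M ^+ 2 / al) <= J u.
  have h1 : f u <= M * `|u| by apply: le_trans (fM u); apply: ler_norm.
  have := Gal u; rewrite /J; move: h1; set x := `|u| => h1 h2.
  have : 0 <= (al * x - M) ^+ 2 / al by rewrite divr_ge0 ?sqr_ge0 // ltW.
  have -> : (al * x - M) ^+ 2 / al = al * x ^+ 2 - 2 * (M * x) + M ^+ 2 / al.
    by field; lra.
  by lra.
have Jinf : has_inf (range J).
  split; first by exists (J 0), 0.
  by exists (- (M ^+ 2 / al)) => _ [u _ <-].
pose m := inf (range J).
have mle u : m <= J u by apply: ge_inf; [case: Jinf | exists u].
have /choice[s sP] k : exists u, J u < m + k.+1%:R^-1.
  have k0 : 0 < k.+1%:R^-1 :> R by rewrite invr_gt0.
  by have [_ [u _ <-] ?] := inf_adherent k0 Jinf; exists u.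
(* [Jvar] at [t = 1] and [t = 1/2] in the direction [v - u] expresses [G (v - u) (v - u)] as
   [2 (J u + J v - 2 J mid)], and the midpoint value is at least [m]. *)
have Jpar u v : al * `|v - u| ^+ 2 <= 2 * (J u + J v - 2 * m).
  apply: le_trans (Gal _) _.
  have := Jvar 2^-1 u (v - u); have := Jvar 1 u (v - u).
  rewrite scale1r (addrC u (v - u)) subrK; have := mle (u + 2^-1 *: (v - u)).
  by move=> ? -> h; lra.
have s_cauchy : cauchy (s @ \oo).
  apply: cauchy_exP => e e0.
  (* Two values of [J] within [al e^2 / 4] of [m] make the right side of [Jpar] less than
     [al e^2]. *)
  have c0 : 0 < al * e ^+ 2 / 4 by rewrite divr_gt0 ?mulr_gt0 ?exprn_gt0.
  have [k _ kP] := near_infty_natSinv_lt (PosNum c0).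
  exists (s k); exists k => // l /= kl; rewrite -ball_normE /=.
  have /= hk := kP k (leqnn k); have /= hl := kP l kl.
  have := Jpar (s l) (s k) => h.
  have h1 : J (s k) < m + al * e ^+ 2 / 4.
    by apply: lt_trans (sP k) _; rewrite ltrD2l.
  have h2 : J (s l) < m + al * e ^+ 2 / 4.
    by apply: lt_trans (sP l) _; rewrite ltrD2l.
  have {}h : al * `|s k - s l| ^+ 2 < al * e ^+ 2 by lra.
  by move: h; rewrite ltr_pM2l // ltr_pXn2r ?nnegrE ?(ltW e0).
have s_cvg : cvg (s @ \oo) by apply/cauchy_cvgP.
exists (lim (s @ \oo)) => v; apply/eqP; rewrite -subr_eq0; apply/eqP.
set u := lim _.
apply: (@linear_quadratic_ge0 _ _ (G v v)).
  by apply: le_trans (Gal v); rewrite mulr_ge0 ?exprn_ge0 // ltW.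
(* If the variation [c] at the limit were negative, then for [s k] close to [u] the variation at
   [s k] would differ from [c] by less than [- c / 2], through the Lipschitz constant [L]. With
   [J (s k) < m - c / 2] this would put [J (s k + t v)] below [m]. *)
move=> t; rewrite leNgt; apply/negP => neg.
set c := 2 * t * _ + _ in neg.
have e0 : 0 < - c / 2 by lra.
pose L := 2 * `|t| * K * `|v| + 1.
have L0 : 0 < L by rewrite ltr_wpDl // !mulr_ge0.
have d0 : 0 < - c / 2 / L by rewrite divr_gt0.
have /cvgrPdist_lt/(_ _ d0) near_u : s @ \oo --> u by [].
have near_k := near_infty_natSinv_lt (PosNum e0).
have [k [kP ksP]] : exists k, k.+1%:R^-1 < - c / 2 /\ `|u - s k| < - c / 2 / L.
  near \oo => k; exists k; split.
    by near: k.
  by near: k.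
have := mle (s k + t *: v); rewrite Jvar => h.
have := sP k => h1.
have h2 : `|2 * t * G (u - s k) v| <= L * `|u - s k|.
  rewrite !normrM (ger0_norm (ler0n _ 2)) /L.
  apply: le_trans (_ : 2 * `|t| * (K * `|u - s k| * `|v|) <= _).
    by rewrite ler_wpM2l ?mulr_ge0.
  by have := normr_ge0 (u - s k); nra.
have {}ksP : L * `|u - s k| < - c / 2 by rewrite mulrC -ltr_pdivlMr.
have := lerNnormlW (le_trans h2 (ltW ksP)); rewrite (formBl Gs) => h3.
have h4 : J (s k) < m + - c / 2 by apply: lt_trans h1 _; rewrite ltrD2l.
have cE : c = 2 * t * (G u v - f v) + t ^+ 2 * G v v by [].
by lra.
Unshelve. all: by end_near. Qed.

(** * Hermitian matrix pencils *)

Section Pencil.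
Local Open Scope sesquilinear_scope.

(* [B] is the Gram matrix of a new inner product: after normalising it to the
   identity, [A] is still hermitian, hence unitarily diagonalisable. *)
Lemma simultaneous_diagonalization (C : numClosedFieldType) n (A B : 'M[C]_n) :
  A ^t* = A -> B ^t* = B ->
  (forall x : 'rV_n, x != 0 -> 0 < (x *m B *m x ^t*) 0 0) ->
  exists (X : 'M[C]_n) (E : 'rV[C]_n),
    X *m B *m X ^t* = 1%:M /\ X *m A *m X ^t* = diag_mx E.
Proof.
have herm (H : 'M[C]_n) : H ^t* = H -> exists (P : 'M[C]_n) (D : 'rV[C]_n),
    P *m P ^t* = 1%:M /\ P *m H *m P ^t* = diag_mx D.
  move=> HH; have /orthomx_spectralP HE : H \is normalmx.
    by apply/normalmxP; rewrite HH.
  have Pu := spectral_unitarymx H; exists (spectralmx H), (spectral_diag H).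
  split; first exact/unitarymxP.
  rewrite {2}HE !mulmxA mulmxV ?spectral_unit // mul1mx -mulmxA.
  by rewrite (unitarymxP Pu) mulmx1.
have trC m p q (M : 'M[C]_(m, p)) (N : 'M[C]_(p, q)) :
    (M *m N) ^t* = N ^t* *m M ^t* by rewrite trmx_mul map_mxM.
move=> HA HB Bpos; have [P [D [PP PBP]]] := herm B HB.
(* [D 0 i] is the value of the form of [B] at row [i] of [P], a nonzero row since [P] is unitary. *)
have D0 i : 0 < D 0 i.
  have := Bpos (row i P); have -> : row i P *m B *m (row i P) ^t* =
      (row i (P *m B *m P ^t*)) *m (delta_mx 0 i) ^t*.
    rewrite -!row_mul !rowE !trC.
    by rewrite !mulmxA.
  rewrite PBP => /(_ _)/wrap[].
    apply/eqP => /(congr1 (fun M => M *m P ^t*)); rewrite mul0mx -row_mul PP.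
    by rewrite row1 => /matrixP/(_ 0 i)/eqP; rewrite !mxE !eqxx oner_eq0.
  rewrite mxE (bigD1 i) //= big1 ?addr0; last first.
    by move=> j ji; rewrite !mxE (negPf ji) andbF /= conjC0 mulr0.
  by rewrite !mxE !eqxx /= conjC1 mulr1 mulr1n.
(* Dividing each row of [P] by the square root of its [B]-value normalises [B] to the identity,
   which the unitary [U] below preserves. *)
pose W : 'M[C]_n := diag_mx (\row_i (sqrtC (D 0 i))^-1) *m P.
have WW : W *m B *m W ^t* = 1%:M.
  rewrite /W trC tr_diag_mx !mulmxA.
  rewrite -(mulmxA (diag_mx _) P) -(mulmxA (diag_mx _) (P *m B)) PBP.
  rewrite map_diag_mx.
  apply/matrixP => i j; rewrite mul_mx_diag mxE mul_mx_diag !mxE /=.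
  have s0 : 0 < sqrtC (D 0 j) by rewrite sqrtC_gt0.
  rewrite geC0_conj ?invr_ge0 ?(ltW s0) //.
  case: eqVneq => [->|_]; last by rewrite mulr0n !mul0r.
  rewrite mulr1n -[X in _ * X * _]sqrtCK expr2 mulrA mulVf ?gt_eqF //.
  by rewrite mul1r mulfV // gt_eqF.
have [U [E [UU UE]]] : exists (P : 'M[C]_n) (D : 'rV[C]_n),
    P *m P ^t* = 1%:M /\ P *m (W *m A *m W ^t*) *m P ^t* = diag_mx D.
  by apply: herm; rewrite !trC !trmxCK HA mulmxA.
have conjUW H : U *m W *m H *m (U *m W) ^t* =
    U *m (W *m H *m W ^t*) *m U ^t* by rewrite trC !mulmxA.
by exists (U *m W), E; rewrite !conjUW WW mulmx1.
Qed.

Lemma real_complex_adjoint (R : rcfType) m n (M : 'M[R]_(m, n)) :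
  (map_mx (real_complex R) M) ^t* = map_mx (real_complex R) M^T.
Proof. by apply/matrixP => i j; rewrite !mxE conj_Creal // complex_real. Qed.

(** For [x = y + i z] the cross terms cancel by symmetry of [B], leaving the sum of the real values
    at [y] and [z]. *)
Lemma complexified_posdef (R : rcfType) n (B : 'M[R]_n) :
  B^T = B -> (forall x : 'rV_n, x != 0 -> 0 < (x *m B *m x^T) 0 0) ->
  forall x : 'rV[R[i]]_n, x != 0 ->
  0 < (x *m map_mx (real_complex R) B *m x ^t*) 0 0.
Proof.
move=> Bs Bpos x x0.
pose y : 'rV[R]_n := map_mx (@complex.Re R) x.
pose z : 'rV[R]_n := map_mx (@complex.Im R) x.
have xE : x = map_mx (real_complex R) y + 'i *: map_mx (real_complex R) z.
  apply/rowP => i; rewrite !mxE; case: (x 0 i) => a b.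
  by apply/eqP; rewrite eq_complex /= ; apply/andP; split; apply/eqP; ring.
have xaE : x ^t* =
    map_mx (real_complex R) y^T - 'i *: map_mx (real_complex R) z^T.
  apply/colP => i; rewrite !mxE; case: (x 0 i) => u v.
  by apply/eqP; rewrite eq_complex /=; apply/andP; split; apply/eqP; ring.
have zy : z *m B *m y^T = y *m B *m z^T.
  rewrite [LHS]mx11_scalar -tr_scalar_mx -mx11_scalar !trmx_mul trmxK Bs.
  by rewrite mulmxA.
have -> : (x *m map_mx (real_complex R) B *m x ^t*) 0 0 =
    real_complex R ((y *m B *m y^T) 0 0 + (z *m B *m z^T) 0 0).
  rewrite {1}xE xaE.
  rewrite !mulmxDl !mulmxBr -!scalemxAl -!scalemxAr -!map_mxM zy.
  move: (y *m B *m y^T) (y *m B *m z^T) (z *m B *m z^T) => p q r.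
  rewrite !mxE; apply/eqP; rewrite eq_complex /=.
  by apply/andP; split; apply/eqP; ring.
have nn (v : 'rV_n) : 0 <= (v *m B *m v^T) 0 0.
  by have [->|/Bpos/ltW//] := eqVneq v 0; rewrite !mul0mx mxE.
rewrite ltcR lt_neqAle addr_ge0 // andbT eq_sym paddr_eq0 //.
apply: contra x0 => /andP[h1 h2].
rewrite xE; have [->|/Bpos] := eqVneq y 0; last by rewrite (eqP h1) ltxx.
have [->|/Bpos] := eqVneq z 0; last by rewrite (eqP h2) ltxx.
by rewrite !map_mx0 scaler0 addr0.
Qed.

(* [d] stands for [(a - B^-1 A) c]. *)
Lemma pencil_lower_bound (R : rcfType) n (A B : 'M[R]_n) (a eps : R) :
  A^T = A -> B^T = B -> 0 <= eps ->
  (forall x : 'rV_n, x != 0 -> 0 < (x *m B *m x^T) 0 0) ->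
  (forall z : R[i], eigenvalue (map_mx (real_complex R) (invmx B *m A)) z ->
     eps%:C <= `|a%:C - z|) ->
  forall c d : 'cV_n, B *m d = a *: (B *m c) - A *m c ->
  eps ^+ 2 * (c^T *m B *m c) 0 0 <= (d^T *m B *m d) 0 0.
Proof.
move=> As Bs eps0 Bpos gap c d dE.
pose rc m n : 'M[R]_(m, n) -> 'M[R[i]]_(m, n) := map_mx (real_complex R).
have [|| | X [E [XB XA]]] :=
    @simultaneous_diagonalization _ _ (rc _ _ A) (rc _ _ B).
- by rewrite real_complex_adjoint As.
- by rewrite real_complex_adjoint Bs.
- exact: complexified_posdef.
have XB1 : X ^t* *m (X *m rc _ _ B) = 1%:M by apply: mulmx1C.
have Bu : B \in unitmx.
  by have [_] := mulmx1_unit XB1; rewrite unitmx_mul map_unitmx => /andP[].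
have XAE : X *m rc _ _ A = diag_mx E *m (X *m rc _ _ B).
  by rewrite -XA -mulmxA XB1 mulmx1.
(* From [X A = E X B], the rows of [X B] are left eigenvectors of [B^-1 A], which is the convention
   of [eigenvalue]. *)
have gapE i : eps%:C <= `|a%:C - E 0 i|.
  apply: gap; apply/eigenvalueP; exists (row i (X *m rc _ _ B)).
    rewrite -row_mul -mulmxA -map_mxM mulmxA mulmxV // mul1mx XAE.
    by apply/rowP => j; rewrite mul_diag_mx !mxE.
  apply/eqP => /(congr1 (fun M => M *m X ^t*)); rewrite mul0mx -row_mul XB.
  by rewrite row1 => /matrixP/(_ 0 i)/eqP; rewrite !mxE !eqxx oner_eq0.
have [y yE] : exists y, y = X *m rc _ _ B *m rc _ _ c by eexists.
(* The entries of [X B v] are the coordinates of [v] in a [B]-orthonormal basis, so this is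
   Parseval's identity. *)
have qE (v : 'cV[R]_n) : ((v^T *m B *m v) 0 0)%:C =
    \sum_i `|(X *m rc _ _ B *m rc _ _ v) i 0| ^+ 2.
  set w := X *m _ *m _.
  have vE : rc _ _ v = X ^t* *m w by rewrite mulmxA XB1 mul1mx.
  have -> : ((v^T *m B *m v) 0 0)%:C = (rc _ _ (v^T *m B *m v)) 0 0
    by rewrite [RHS]mxE.
  rewrite /rc !map_mxM -real_complex_adjoint -/(rc _ _ _).
  have -> : (rc _ _ v) ^t* = w ^t* *m X by rewrite vE trmx_mul map_mxM trmxCK.
  rewrite -[_ *m rc _ _ B]mulmxA -[LHS]/((_ *m _) 0 0).
  rewrite -mulmxA -/w mxE; apply: eq_bigr => i _.
  by rewrite !mxE normCK mulrC.
rewrite -lecR rmorphM /= !qE mulr_sumr; apply: ler_sum => i _.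
(* In these coordinates [a - B^-1 A] multiplies entry [i] by [a - E 0 i], so the estimate reduces to
   one entry at a time. *)
have -> : X *m rc _ _ B *m rc _ _ d = diag_mx (\row_i (a%:C - E 0 i)) *m y.
  rewrite -mulmxA -map_mxM dE map_mxB map_mxZ map_mxM mulmxBr map_mxM.
  rewrite -scalemxAr !mulmxA XAE -(mulmxA (diag_mx E)) -yE.
  by apply/colP => j; rewrite !mul_diag_mx !mxE mulrBl.
rewrite -yE mul_diag_mx !mxE normrM exprMn ler_wpM2r ?exprn_ge0 //.
by rewrite rmorphXn /= lerXn2r ?nnegrE ?gapE // ler0c.
Qed.

End Pencil.

(** * Duality pairing and bounded forms *)

Lemma linear_morphisms (R : pzRingType) (U V : lmodType R) (f : U -> V) :
  linear f ->
  [/\ f 0 = 0, {morph f : u v / u + v}, {morph f : u v / u - v}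
    & forall a, {morph f : u / a *: u}].
Proof.
move=> flin; have fB := GRing.zmod_morphism_linear flin.
have f0 : f 0 = 0 by rewrite -[0 in LHS](subrr 0) fB subrr.
split=> // [u v|]; last exact: GRing.scalable_linear flin.
by rewrite -[u in LHS]scale1r flin scale1r.
Qed.

Section DualForm.
Context {R : realType} {V : normedModType R}.

Lemma dual_linear (f : dual V) : linear f.
Proof. by case: f => f /= /asboolP[]. Qed.

(** Rescale [v] to the unit sphere; boundedness of [f] ensures that the supremum is an upper
    bound. *)
Lemma dual_norm_bound (f : dual V) v : `|f v| <= dual_norm f * `|v|.
Proof.
have flin := dual_linear f.
have [f0 _ _ fZ] := linear_morphisms flin.
have [->|v0] := eqVneq v 0; first by rewrite f0 !normr0 mulr0.
have nv0 : 0 < `|v| by rewrite normr_gt0.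
rewrite -ler_pdivrMr //; apply: sup_upper_bound; last first.
  exists (`|v|^-1 *: v); last by rewrite fZ normrZ normfV normr_id mulrC.
  by rewrite /= normrZ normfV normr_id mulVf ?gt_eqF.
split; first by exists `|f 0|, 0 => //=; rewrite normr0.
case: f {flin f0 fZ} => f /= /[dup] fb /asboolP[_ [M fM]].
(* The constant [M] may be negative, hence its absolute value. *)
exists `|M| => _ [w /= w1 <-]; apply: le_trans (fM w) _.
apply: le_trans (_ : `|M| * `|w| <= _); first by rewrite ler_wpM2r // ler_norm.
by rewrite ler_piMr.
Qed.

Lemma operator_symmetric_form (A : {linear V -> dual V}) :
  self_adjoint A -> symmetric_form (fun u v => A u v : R).
Proof. by move=> As; split=> // a u v w; rewrite linearP. Qed.

Lemma operator_bounded_form (A : {linear V -> dual V}) :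
  bounded_operator A -> bounded_form (fun u v => A u v : R).
Proof.
case=> M AM; exists `|M| => // u v; apply: le_trans (dual_norm_bound _ _) _.
rewrite ler_wpM2r //; apply: le_trans (AM u) _.
by rewrite ler_wpM2r // ler_norm.
Qed.

Lemma bounded_formB (F G : V -> V -> R) :
  bounded_form F -> bounded_form G -> bounded_form (fun u v => F u v - G u v).
Proof.
case=> [M M0 FM] [N N0 GN]; exists (M + N) => [|u v]; first exact: addr_ge0.
apply: le_trans (ler_normB _ _) _; rewrite !mulrDl; exact: lerD.
Qed.

Lemma bounded_formZ c (F : V -> V -> R) :
  bounded_form F -> bounded_form (fun u v => c * F u v).
Proof.
case=> [M M0 FM]; exists (`|c| * M) => [|u v]; first exact: mulr_ge0.
by rewrite normrM -!mulrA ler_wpM2l // mulrA.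
Qed.

Lemma bounded_form_comp (F : V -> V -> R) (S : V -> V) :
  (exists2 C, 0 <= C & forall u, `|S u| <= C * `|u|) ->
  bounded_form F -> bounded_form (fun u v => F (S u) (S v)).
Proof.
case=> [C C0 SC] [M M0 FM]; exists (M * C ^+ 2) => [|u v].
  by rewrite mulr_ge0 ?exprn_ge0.
apply: le_trans (FM _ _) _.
have -> : M * C ^+ 2 * `|u| * `|v| = (M * (C * `|u|)) * (C * `|v|) by ring.
by rewrite ler_pM ?mulr_ge0 ?ler_wpM2l.
Qed.

(** This is continuity of [u |-> F u u] in quantitative form; it carries the Galerkin estimate from
    the subspaces to [V]. *)
Lemma form_ge0_limit (F : V -> V -> R) w :
  symmetric_form F -> bounded_form F ->
  (forall d, 0 < d -> exists2 x, `|w - x| < d & 0 <= F x x) -> 0 <= F w w.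
Proof.
move=> Fs [M M0 FM] apx; rewrite leNgt; apply/negP => neg.
(* At distance [e <= 1] from [w] the value of the form changes by at most
   [2 M |w| e + M e^2 <= L e]; the final [+ 1] keeps [L] positive. *)
pose L := M * (2 * `|w| + 1) + 1.
have L0 : 0 < L by rewrite ltr_wpDl // mulr_ge0 // addr_ge0 // mulr_ge0.
pose d := Num.min 1 (- F w w / L).
have d0 : 0 < d by rewrite lt_min ltr01 divr_gt0 // oppr_gt0.
have [x xd Fx] := apx d d0.
have e1 : `|x - w| < 1 by rewrite distrC (lt_le_trans xd) // ge_min lexx.
have e2 : `|x - w| * L < - F w w.
  by rewrite -ltr_pdivlMr // distrC (lt_le_trans xd) // ge_min lexx orbT.
have : F x x = F w w + 2 * 1 * F w (x - w) + 1 ^+ 2 * F (x - w) (x - w).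
  by rewrite -form_quadratic // scale1r addrC subrK.
have := ler_norm (F w (x - w)); have := FM w (x - w).
have := ler_norm (F (x - w) (x - w)); have := FM (x - w) (x - w).
rewrite /L in e2; move: e1 e2 (normr_ge0 (x - w)) (normr_ge0 w).
move: `|x - w| `|w| => e W e1 e2 eg W0 h1 h2 h3 h4 h5.
have h6 : M * e * e <= M * e by rewrite ler_piMr ?mulr_ge0 // ltW.
nra.
Qed.

End DualForm.

(** * Bounded invertibility of shifted self-adjoint operators *)

(** A right inverse chosen pointwise is linear because [T] is linear and injective. As [nrm] is an
    arbitrary function, injectivity cannot be read off the bound. General scalars cover both [V] and
    its complexification. *)
Lemma has_bounded_inverse_intro (R : realType) (K : nzRingType)
    (U : lmodType K) (nrm : U -> R) (T : U -> U) :
  linear T -> (forall y, exists x, T x = y) -> (forall x, T x = 0 -> x = 0) ->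
  (exists M, forall x, nrm x <= M * nrm (T x)) -> has_bounded_inverse nrm T.
Proof.
move=> Tlin Tsurj Tinj [M TM].
have {}Tinj : injective T.
  have [_ _ TB _] := linear_morphisms Tlin.
  move=> x y xy; apply/eqP; rewrite -subr_eq0; apply/eqP/Tinj.
  by rewrite TB xy subrr.
have /choice[S TS] := Tsurj.
have Slin : linear S by move=> a u v; apply: Tinj; rewrite Tlin !TS.
pose Sl : {linear U -> U} := HB.pack S (GRing.isLinear.Build _ _ _ _ S Slin).
exists Sl; split=> [|x|x]; [exists M => x| exact: TS |exact/Tinj/TS].
by have := TM (S x); rewrite TS.
Qed.

Section SelfAdjoint.
Context {R : realType} {V : completeNormedModType R}.
Context {G : V -> V -> R} {S : V -> V}.
Hypotheses (Gs : symmetric_form G) (Gb : bounded_form G) (Gc : coercive_form G).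
Hypotheses (Slin : linear S)
  (Sb : exists2 C, 0 <= C & forall u, `|S u| <= C * `|u|)
  (Ss : forall u v, G (S u) v = G u (S v)).

Lemma form_ge0 u : 0 <= G u u.
Proof.
case: Gc => al al0 /(_ u); apply: le_trans.
by rewrite mulr_ge0 ?exprn_ge0 // ltW.
Qed.

Lemma form_eq0 u : (forall v, G u v = 0) -> u = 0.
Proof.
move=> /(_ u) Gu; case: Gc => al al0 /(_ u); rewrite Gu pmulr_rle0 //.
by move=> h; apply/eqP; rewrite -normr_eq0 -sqrf_eq0 eq_le h exprn_ge0.
Qed.

(** By self-adjointness the weak form of the equation is [G (S w) (S v) + b^2 G w v = G g v]; the
    lower bound makes its left side coercive with constant [e * al]. *)
Lemma square_shift_surjective (b e : R) : 0 < e ->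
  (forall u, e * G u u <= G (S u) (S u) + b ^+ 2 * G u u) ->
  forall g, exists w, S (S w) + b ^+ 2 *: w = g.
Proof.
move=> e0 low g.
have SGs : symmetric_form (fun u v => G (S u) (S v)).
  split=> [u v|a u v w]; first exact: form_sym.
  by rewrite Slin (form_linearl Gs).
have [|||||w wE] := @symmetric_lax_milgram _ V
    (fun u v => G (S u) (S v) - (- b ^+ 2) * G u v) (G g).
- split=> [u v|a u v w]; first by rewrite (form_sym SGs) (form_sym Gs u).
  by rewrite (form_linearl SGs) (form_linearl Gs); ring.
- by apply: bounded_formB; [exact: bounded_form_comp|exact: bounded_formZ].
- case: Gc => al al0 Gal; exists (e * al) => [|u]; first exact: mulr_gt0.
  rewrite mulNr opprK; apply: le_trans (low u).
  by rewrite -mulrA ler_pM2l.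
- by move=> a u v; rewrite (formDr Gs) (formZr Gs).
- by case: Gb => M M0 GM; exists (M * `|g|) => v.
exists w; apply/eqP; rewrite -subr_eq0; apply/eqP/form_eq0 => v.
by rewrite (formBl Gs) (formDl Gs) (formZl Gs) -wE Ss; ring.
Qed.

(* With [Q = S^2 + b^2], [Q w = f] and [Q w' = g], the pair
   [(S w + b w', S w' - b w)] solves the system. *)
Lemma complex_shift_surjective (b e : R) : 0 < e ->
  (forall u, e * G u u <= G (S u) (S u) + b ^+ 2 * G u u) ->
  forall f g, exists u v, S u - b *: v = f /\ S v + b *: u = g.
Proof.
move=> e0 low f g; have [_ SD SB SZ] := linear_morphisms Slin.
have [w wE] := square_shift_surjective e0 low f.
have [w' w'E] := square_shift_surjective e0 low g.
exists (S w + b *: w'), (S w' - b *: w).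
rewrite SD SB !SZ scalerBr scalerDr !scalerA -expr2 -{}wE -{}w'E; split.
  by rewrite opprB [_ - b *: S w']addrC addrA addrK.
by rewrite addrA addrNK.
Qed.

Lemma real_shift_invertible (e : R) : 0 < e ->
  (forall u, e * G u u <= G (S u) (S u)) ->
  has_bounded_inverse (fun u : V => `|u|) S.
Proof.
move=> e0 low.
have bound : exists M, forall x, `|x| <= M * `|S x|.
  case: Gc => al al0 Gal; case: Gb => M M0 GM.
  (* The constant comes from [e al |x|^2 <= e G x x <= G (S x) (S x) <= M |S x|^2]. *)
  exists (Num.sqrt (M / (e * al))) => x.
  rewrite -ler_sqr ?nnegrE ?mulr_ge0 ?sqrtr_ge0 // exprMn sqr_sqrtr; last first.
    by rewrite divr_ge0 // ltW // mulr_gt0.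
  rewrite mulrAC ler_pdivlMr ?mulr_gt0 //.
  have := low x; have := Gal x; have := GM (S x) (S x).
  have := ler_norm (G (S x) (S x)); nra.
apply: has_bounded_inverse_intro => //.
- move=> f; have [|u [v [uE _]]] := complex_shift_surjective (b := 0) e0 _ f 0.
    by move=> u; rewrite expr0n /= mul0r addr0.
  by exists u; rewrite -uE scale0r subr0.
case: bound => M SM x Sx; have := SM x.
by rewrite Sx normr0 mulr0 normr_le0 => /eqP.
Qed.

End SelfAdjoint.

Lemma shift_linear (R : realType) (V : lmodType R) (a : R) (T : V -> V) :
  linear T -> linear (fun u => a *: u - T u).
Proof.
move=> Tlin c u v; rewrite Tlin scalerBr !scalerDr !scalerA (mulrC a c).
by rewrite opprD addrACA.
Qed.

Lemma shift_bounded (R : realType) (V : normedModType R) (a : R) (T : V -> V) :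
  (exists2 C, 0 <= C & forall u, `|T u| <= C * `|u|) ->
  exists2 C, 0 <= C & forall u, `|a *: u - T u| <= C * `|u|.
Proof.
case=> C C0 TC; exists (`|a| + C) => [|u]; first exact: addr_ge0.
by apply: le_trans (ler_normB _ _) _; rewrite mulrDl normrZ lerD.
Qed.

Lemma shift_self_adjoint (R : realType) (V : lmodType R) (G : V -> V -> R)
    (a : R) (T : V -> V) :
  symmetric_form G -> (forall u v, G (T u) v = G u (T v)) ->
  forall u v, G (a *: u - T u) v = G u (a *: v - T v).
Proof.
move=> Gs Ts u v.
by rewrite (formBl Gs) (formBr Gs) (formZl Gs) (formZr Gs) Ts.
Qed.

Lemma complex_shift_invertible (R : realType) (V : completeNormedModType R)
    (G : V -> V -> R) (T : V -> V) (lambda : R[i]) :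
  symmetric_form G -> bounded_form G -> coercive_form G ->
  linear T -> (exists2 C, 0 <= C & forall u, `|T u| <= C * `|u|) ->
  (forall u v, G (T u) v = G u (T v)) -> complex.Im lambda != 0 ->
  has_bounded_inverse complex_norm
    (fun p : complexification V => lambda *: p - complexify T p).
Proof.
move=> Gs Gb Gc Tlin Tb Ts; case: lambda => a b /= b0.
pose S u := a *: u - T u.
have Slin : linear S by exact: shift_linear.
have Sb := shift_bounded a Tb.
have Ss := shift_self_adjoint a Gs Ts.
have b2 : 0 < b ^+ 2 by rewrite exprn_even_gt0.
(* The lower bound needs no spectral gap here: [b^2] itself provides it. *)
have low u : b ^+ 2 * G u u <= G (S u) (S u) + b ^+ 2 * G u u.
  by rewrite lerDr form_ge0.
have shiftE (p : complexification V) : (a +i* b) *: p - complexify T p =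
    (S p.1 - b *: p.2, S p.2 + b *: p.1).
  by congr (_, _); rewrite /S /= addrAC.
have bound : exists M, forall p : complexification V,
    complex_norm p <= M * complex_norm ((a +i* b) *: p - complexify T p).
  case: Gc => al al0 Gal; case: Gb => M M0 GM.
  have c0 : 0 < b ^+ 2 * al by exact: mulr_gt0.
  exists (Num.sqrt (M / (b ^+ 2 * al))) => -[u v]; rewrite shiftE.
  have sq0 (x y : V) : 0 <= `|x| ^+ 2 + `|y| ^+ 2
    by rewrite addr_ge0 ?exprn_ge0.
  rewrite /complex_norm -ler_sqr ?nnegrE ?mulr_ge0 ?sqrtr_ge0 // exprMn.
  rewrite !sqr_sqrtr //=; last by rewrite divr_ge0 // ltW.
  rewrite mulrAC ler_pdivlMr //.
  set f := S u - _; set g := S v + _.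
  (* The cross terms [- 2 b G (S u) v] and [2 b G (S v) u] cancel because [S] is self-adjoint. *)
  have fg : b ^+ 2 * (G u u + G v v) <= G f f + G g g.
    have : G f f + G g g =
        G (S u) (S u) + G (S v) (S v) + b ^+ 2 * (G u u + G v v).
      rewrite /f /g !(formBl Gs, formBr Gs, formDl Gs, formDr Gs).
      rewrite !(formZl Gs, formZr Gs) !Ts.
      rewrite (form_sym Gs v u) (form_sym Gs v (T u)) Ts.
      by ring.
    move=> ->; rewrite lerDr addr_ge0 //; apply: form_ge0.
      by exists al.
    by exists al.
  have := GM f f; have := GM g g.
  have := ler_norm (G f f); have := ler_norm (G g g).
  have := ler_wpM2l (ltW b2) (Gal u); have := ler_wpM2l (ltW b2) (Gal v).
  nra.
have TClin : linear (complexify T).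
  have [_ TD TB TZ] := linear_morphisms Tlin.
  by move=> c p q; congr (_, _); rewrite /= TD ?TB ?TD !TZ.
refine (has_bounded_inverse_intro _ _ _ _).
- move=> c p q; rewrite TClin scalerDr opprD addrACA scalerBr.
  congr (_ - _ + _).
  by rewrite !scalerA mulrC.
- move=> [f g].
  have [u [v [uE vE]]] :=
    complex_shift_surjective Gs Gb Gc Slin Sb Ss b2 low f g.
  by exists (u, v); rewrite shiftE /= uE vE.
- move=> p Tp; case: (bound) => M /(_ p); rewrite Tp.
have -> : complex_norm (0 : complexification V) = 0.
  by rewrite /complex_norm /= normr0 expr0n addr0 sqrtr0.
rewrite mulr0 => h.
have : `|p.1| ^+ 2 + `|p.2| ^+ 2 == 0.
  rewrite -[eqbLHS]sqr_sqrtr ?addr_ge0 ?exprn_ge0 // sqrf_eq0.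
  by rewrite eq_le h sqrtr_ge0.
rewrite paddr_eq0 ?exprn_ge0 // !sqrf_eq0 !normr_eq0.
by case: p {h Tp} => u v /= /andP[/eqP-> /eqP->].
exact: bound.
Qed.

(** * The preconditioned operator *)

Section PreconditionedOperator.
Context {R : realType} {V : completeNormedModType R}.
Context {A B : {linear V -> dual V}}.
Hypotheses (A_bounded : bounded_operator A) (B_bounded : bounded_operator B).
Hypothesis B_coercive : coercive B.
Hypotheses (A_sym : self_adjoint A) (B_sym : self_adjoint B).
Let T u := inverse_operator B (A u).

(** Lax-Milgram makes [B] surjective, and the choice-based inverse is a right inverse on the
    image. *)
Lemma coercive_inverse_operatorK : cancel (inverse_operator B) B.
Proof.
move=> f; apply: pinvK; rewrite inE.
have [|u uE] := symmetric_lax_milgram (operator_symmetric_form B_sym)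
    (operator_bounded_form B_bounded) B_coercive (dual_linear f).
  by exists (dual_norm f) => v; apply: dual_norm_bound.
by exists u => //; apply: val_inj; apply: funext.
Qed.

Lemma preconditionedE u v : B (T u) v = A u v.
Proof. by rewrite coercive_inverse_operatorK. Qed.

Lemma preconditioned_linear : linear T.
Proof.
have Bs := operator_symmetric_form B_sym.
move=> a u v; apply/eqP; rewrite -subr_eq0; apply/eqP.
apply: (form_eq0 (G := fun u v => B u v : R) B_coercive) => w.
rewrite (formBl Bs) (form_linearl Bs) !preconditionedE.
by rewrite (form_linearl (operator_symmetric_form A_sym)) subrr.
Qed.

(** Divide [al |T u|^2 <= B (T u) (T u) = A u (T u) <= M |u| |T u|] by [|T u|], when this is
    nonzero. *)
Lemma preconditioned_bounded :
  exists2 C, 0 <= C & forall u, `|T u| <= C * `|u|.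
Proof.
have [M M0 AM] := operator_bounded_form A_bounded.
case: B_coercive => al al0 Bal; exists (M / al) => [|u].
  by rewrite divr_ge0 // ltW.
have [->|Tu] := eqVneq (T u) 0.
  by rewrite normr0 mulr_ge0 ?divr_ge0 ?(ltW al0).
rewrite mulrAC ler_pdivlMr // -(ler_pM2r (_ : 0 < `|T u|)) ?normr_gt0 //.
apply: le_trans (AM u (T u)); apply: le_trans (ler_norm _).
by rewrite -preconditionedE mulrAC -expr2 mulrC.
Qed.

Lemma preconditioned_self_adjoint u v : B (T u) v = B u (T v).
Proof. by rewrite [RHS]B_sym !preconditionedE A_sym. Qed.

End PreconditionedOperator.

(** * Galerkin matrices and the discrete lower bound *)

Section Galerkin.
Context {R : realType} {V : normedModType R}.
Context {n : nat} {phi : 'I_n -> V}.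

Definition combination (c : 'cV[R]_n) : V := \sum_i c i 0 *: phi i.

(** The arguments swap because entry [(i, j)] pairs [A (phi j)] with [phi i]. *)
Lemma galerkin_form (A : {linear V -> dual V}) (x y : 'cV[R]_n) :
  (x^T *m galerkin_matrix A phi *m y) 0 0 =
  A (combination y) (combination x).
Proof.
have sumE (f : V -> R^o) (z : 'cV[R]_n) : linear f ->
    f (combination z) = \sum_i z i 0 * f (phi i).
  move=> /linear_morphisms[f0 fD _ fZ].
  by rewrite /combination (big_morph f fD f0); apply: eq_bigr => i _; apply: fZ.
rewrite -mulmxA mxE (sumE _ x (dual_linear _)); apply: eq_bigr => i _.
rewrite !mxE.
congr (_ * _); rewrite (sumE (fun u => A u (phi i))); last first.
  by move=> a u v; rewrite linearP.
by apply: eq_bigr => j _; rewrite !mxE mulrC.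
Qed.

Lemma galerkin_symmetric (A : V -> dual V) :
  self_adjoint A -> (galerkin_matrix A phi)^T = galerkin_matrix A phi.
Proof. by move=> As; apply/matrixP => i j; rewrite !mxE As. Qed.

Lemma galerkin_posdef (B : {linear V -> dual V}) (W : set V) :
  coercive B -> is_basis W phi ->
  forall x : 'rV_n, x != 0 -> 0 < (x *m galerkin_matrix B phi *m x^T) 0 0.
Proof.
move=> [al al0 Bal] [_ free _] x x0.
rewrite -{1}(trmxK x) galerkin_form; apply: lt_le_trans (Bal _).
rewrite mulr_gt0 // exprn_gt0 // normr_gt0; apply: contra x0 => /eqP c0.
apply/eqP/rowP => i; rewrite mxE.
by rewrite -(free (fun i => x^T i 0) c0 i) mxE.
Qed.

End Galerkin.

Lemma posdef_unitmx (R : realFieldType) n (B : 'M[R]_n) :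
  (forall x : 'rV_n, x != 0 -> 0 < (x *m B *m x^T) 0 0) -> B \in unitmx.
Proof.
move=> Bpos; rewrite -row_free_unit; apply: inj_row_free => v vB.
by apply: contraTeq isT => /Bpos; rewrite vB mul0mx mxE ltxx.
Qed.

(* [r] is the [B]-orthogonal projection of [a u - B^-1 A u] onto [W], whose
   norm the matrix estimate bounds from below. *)
Lemma galerkin_lower_bound (R : realType) (V : completeNormedModType R)
    (A B : {linear V -> dual V}) (W : set V) n (phi : 'I_n -> V) (a eps : R) :
  bounded_operator B -> coercive B ->
  self_adjoint A -> self_adjoint B -> is_basis W phi -> 0 <= eps ->
  (forall z : R[i], eigenvalue (map_mx (real_complex R)
     (invmx (galerkin_matrix B phi) *m galerkin_matrix A phi)) z ->
     eps%:C <= `|a%:C - z|) ->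
  forall u s, W u -> s = a *: u - inverse_operator B (A u) ->
  eps ^+ 2 * B u u <= B s s.
Proof.
move=> B_bounded B_coercive A_sym B_sym basis eps0 gap u s Wu sE.
have Bs := operator_symmetric_form B_sym.
have Bpos := galerkin_posdef B_coercive basis.
have Bu := posdef_unitmx Bpos.
pose gA := galerkin_matrix A phi; pose gB := galerkin_matrix B phi.
have [c uE] : exists c : 'cV_n, u = combination (phi := phi) c.
  case: basis => _ _ /(_ u Wu)[c ->]; exists (\col_i c i).
  by apply: eq_bigr => i _; rewrite mxE.
(* [d] solves the normal equations of the [B]-orthogonal projection of [s]. *)
pose d := invmx gB *m (a *: (gB *m c) - gA *m c).
have dE : gB *m d = a *: (gB *m c) - gA *m c by rewrite mulKVmx.
pose r := combination (phi := phi) d.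
have rr : B r r = B s r :> R.
  rewrite -galerkin_form -mulmxA dE mulmxBr -scalemxAr !mulmxA.
  rewrite [LHS]mxE [X in X + _]mxE [X in _ + X]mxE !galerkin_form -uE.
  by rewrite sE (formBl Bs) (formZl Bs) preconditionedE.
have := pencil_lower_bound (galerkin_symmetric A_sym) (galerkin_symmetric B_sym)
  eps0 Bpos gap dE.
rewrite !galerkin_form -uE => /le_trans; apply.
(* By [rr], [s - r] is [B]-orthogonal to [r], so [B (s - r) (s - r) = B s s - B r r]. *)
have := form_ge0 (G := fun u v => B u v : R) B_coercive (s - r).
rewrite (formBl Bs) !(formBr Bs) (form_sym Bs r s) -rr; lra.
Qed.

(** * Approximation of the spectrum *)

Theorem corollary4p3 (R : realType) (V : completeNormedModType R)
  (inner : {dot V for idfun})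
  (norm_inner : forall v : V, `|v| ^+ 2 = inner v v)
  (V_infinite : infinite_dim V)
  (A B : {linear V -> dual V})
  (A_bounded : bounded_operator A) (B_bounded : bounded_operator B)
  (A_coercive : coercive A) (B_coercive : coercive B)
  (A_self_adjoint : self_adjoint A) (B_self_adjoint : self_adjoint B)
  (Vn : nat -> set V)
  (Vn_subspace : forall n, linear_subspace (Vn n))
  (Vn_dim : forall n, has_dim (Vn n) n)
  (Vn_approx : forall w : V, distance_to (Vn n) w @[n --> \oo] --> (0 : R))
  (phi : forall n, 'I_n -> V)
  (phi_basis : forall n, is_basis (Vn n) (phi n)) :
  forall lambda : R[i],
    spectrum (fun u : V => inverse_operator B (A u)) lambda ->
  forall eps : R, 0 < eps ->
  exists (n : nat) (lambda' : R[i]),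
    eigenvalue
      (map_mx (real_complex R)
         (invmx (galerkin_matrix B (phi n)) *m galerkin_matrix A (phi n)))
      lambda'
    /\ `|lambda - lambda'| < eps%:C.
Proof.
move=> lambda spec eps eps0.
have Bs := operator_symmetric_form B_self_adjoint.
have Bb := operator_bounded_form B_bounded.
set T := fun u => _ in spec.
have Tlin : linear T by apply: preconditioned_linear.
have Tb : exists2 C, 0 <= C & forall u, `|T u| <= C * `|u|.
  exact: preconditioned_bounded.
have Ts u v : B (T u) v = B u (T v) by apply: preconditioned_self_adjoint.
move: spec; rewrite /spectrum /=; case: eqP => [|/eqP] lam; last first.
  by case; apply: (complex_shift_invertible (G := fun u v => B u v)).
have {lam} -> : lambda = (complex.Re lambda)%:C.
  by case: lambda lam => a b /= ->.
move: (complex.Re lambda) => a /= spec; apply: contrapT => no_eig; apply: spec.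
have gap n (z : R[i]) : eigenvalue (map_mx (real_complex R)
      (invmx (galerkin_matrix B (phi n)) *m galerkin_matrix A (phi n))) z ->
    eps%:C <= `|a%:C - z|.
  (* The order on [R[i]] is partial, so negating [<] requires both sides to be real. *)
  move=> zeig; rewrite real_leNgt ?normr_real ?complex_real //.
  by apply/negP => zlt; apply: no_eig; exists n, z.
have Slin := shift_linear a Tlin.
have Sb := shift_bounded a Tb.
have Ss := shift_self_adjoint a Bs Ts.
apply: (real_shift_invertible Bs Bb B_coercive Slin Sb Ss (e := eps ^+ 2)).
  exact: exprn_gt0.
move=> w; rewrite -subr_ge0.
(* The lower bound at [w] is nonnegativity of a single bounded form, known on every [Vn n] and
   passed to the limit. *)
apply: (form_ge0_limit
  (F := fun u v => (B (a *: u - T u) (a *: v - T v) : R) - eps ^+ 2 * B u v)).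
- split=> [u v|c u v x]; first by rewrite (form_sym Bs) (form_sym Bs u).
  by rewrite [a *: _ - _]Slin !(form_linearl Bs); ring.
- apply: bounded_formB; last exact: bounded_formZ.
  exact: (bounded_form_comp Sb Bb).
move=> d d0.
have /cvgrPdist_lt/(_ d d0)[n _ /(_ n (leqnn n))] := Vn_approx w.
rewrite /= sub0r normrN => dist_lt.
(* The infimum need not be attained; the slack [d - distance_to (Vn n) w] yields a [v] in [Vn n] at
   distance less than [d] from [w]. *)
have dinf : has_inf [set `|w - v| | v in Vn n].
  split; last by exists 0 => _ [v _ <-].
  exists `|w - 0|, 0 => //; case: (Vn_subspace n) => + _.
  by rewrite !inE.
have gap0 : 0 < d - distance_to (Vn n) w.
  by rewrite subr_gt0; apply: le_lt_trans dist_lt; apply: ler_norm.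
have [_ [v Vv <-]] := inf_adherent gap0 dinf.
rewrite [ltRHS]addrC subrK => wv; exists v => //; rewrite subr_ge0.
exact: (galerkin_lower_bound B_bounded B_coercive A_self_adjoint
  B_self_adjoint (phi_basis n) (ltW eps0) (gap n) Vv erefl).
Qed.
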